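(* For every real $x$ and every integer $n\ge 0$, $$\sum_{m=0}^{n}D_{m,\lambda}^{Y}(x){n\brace m}_{\lambda}= \sum_{j=0}^{n}\sum_{l=0}^{j}(-1)^{l}\binom{n}{j}E\big[\langle Y\rangle_{l,\lambda}\big]{j\brace l}_{\lambda}F_{n-j,\lambda}(x).$$
   Context: Let $\lambda$ be a nonzero real number. Set $(x)_{0,\lambda}=1$, $(x)_{k,\lambda}=x(x-\lambda)\cdots(x-(k-1)\lambda)$, $\langle x\rangle_{0,\lambda}=1$, $\langle x\rangle_{k,\lambda}=x(x+\lambda)\cdots(x+(k-1)\lambda)$, and $(x)_0=1$, $(x)_k=x(x-1)\cdots(x-k+1)$ for $k\ge 1$. The degenerate exponential is $e_{\lambda}^{x}(t)=\sum_{k\ge 0}(x)_{k,\lambda}\frac{t^{k}}{k!}$, $e_\lambda(t)=e_\lambda^1(t)$ (so $e_\lambda^x(t)=(1+\lambda t)^{x/\lambda}$ for $t$ near $0$). All generating functions below are power series in $t$ near $0$. The degenerate Stirling numbers of the second kind ${n\brace k}_{\lambda}$ are defined by $(x)_{n,\lambda}=\sum_{k=0}^{n}{n\brace k}_{\lambda}(x)_{k}$ for $n\ge 0$. The degenerate Fubini polynomials $F_{n,\lambda}(x)$ are defined by $\frac{1}{1-x(e_{\lambda}(t)-1)}=\sum_{n\ge 0}F_{n,\lambda}(x)\frac{t^{n}}{n!}$. $Y$ is a real random variable whose moment generating function $E[e^{tY}]=\sum_{n\ge 0}E[Y^n]\frac{t^n}{n!}$ exists for $|t|<r$, for some $r>0$.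 $E$ denotes expectation. The probabilistic degenerate derangement polynomials of the second kind associated with $Y$, $D_{n,\lambda}^{Y}(x)$, are defined by $$\frac{1}{1-xt}E\big[e_{\lambda}^{-Y}(t)\big]=\sum_{n=0}^{\infty}D_{n,\lambda}^{Y}(x)\frac{t^{n}}{n!}.$$ *)

(* Defs.v *)
From mathcomp Require Import all_boot all_order all_algebra.
From mathcomp Require Import all_classical all_reals all_analysis.
Set Implicit Arguments.
Unset Strict Implicit.
Unset Printing Implicit Defensive.
Import Order.TTheory GRing.Theory Num.Theory.
Import numFieldNormedType.Exports.
Local Open Scope classical_set_scope.
Local Open Scope ring_scope.

Definition falling (R : realType) (x : R) (k : nat) : R :=
  \prod_(i < k) (x - i%:R).

Definition dfalling (R : realType) (lambda x : R) (k : nat) : R :=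
  \prod_(i < k) (x - i%:R * lambda).

Definition drising (R : realType) (lambda x : R) (k : nat) : R :=
  \prod_(i < k) (x + i%:R * lambda).

(* The series defining $e_\lambda^x(t)$ converges whenever |lambda * t| < 1, and the
   value is only meaningful for such t. *)
Definition dexp (R : realType) (lambda x t : R) : R :=
  limn (pseries (fun k => dfalling lambda x k / k`!%:R) t).

(* f(t) = \sum_(n >= 0) a n * t^n / n! for all t in a neighbourhood of 0; this
   determines the sequence a. *)
Definition is_egf (R : realType) (f : R -> R) (a : nat -> R) : Prop :=
  \forall t \near (0 : R),
    pseries (fun n => a n / n`!%:R) t @ \oo --> f t.

(* St n k is ${n \brace k}_\lambda$; only the values with k <= n are
   constrained, and these are determined uniquely. *)
Definition is_degenerate_stirling2 (R : realType) (lambda : R)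
    (St : nat -> nat -> R) : Prop :=
  forall (n : nat) (x : R),
    dfalling lambda x n = \sum_(k < n.+1) St n k * falling x k.

Definition is_degenerate_fubini (R : realType) (lambda : R)
    (F : nat -> R -> R) : Prop :=
  forall x : R,
    is_egf (fun t => (1 - x * (dexp lambda 1 t - 1))^-1) (fun n => F n x).

Definition has_mgf (d : measure_display) (T : measurableType d)
    (R : realType) (P : probability T R) (Y : {RV P >-> R}) : Prop :=
  exists2 r : R, 0 < r & forall t : R, `|t| < r -> ('M_P Y t < +oo)%E.

(* When has_mgf Y holds, the expectation is finite for t near 0, so that fine
   does not alter it. *)
Definition is_prob_derangement2 (d : measure_display) (T : measurableType d)
    (R : realType) (P : probability T R) (Y : {RV P >-> R}) (lambda : R)
    (D : nat -> R -> R) : Prop :=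
  forall x : R,
    is_egf (fun t => (1 - x * t)^-1 * fine 'E_P[fun w => dexp lambda (- Y w) t])
           (fun n => D n x).

(* Main.v *)
Require Import Defs.
From mathcomp Require Import all_boot all_order all_algebra.
From mathcomp Require Import ring lra.
From mathcomp Require Import all_classical all_reals all_analysis.
From mathcomp Require Import measurable_realfun.
Set Implicit Arguments.
Unset Strict Implicit.
Unset Printing Implicit Defensive.
Import Order.TTheory GRing.Theory Num.Theory.
Import numFieldNormedType.Exports.
Local Open Scope classical_set_scope.
Local Open Scope ring_scope.

(** Write [a_l = E[(-Y)_{l,lambda}] = (-1)^l E[<Y>_{l,lambda}]].  The identity
    compares coefficients after the substitution [t := e_lambda(t) - 1] in
      [(1 - x t) * (sum_n D_n t^n/n!) = sum_n a_n t^n/n!].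
    On coefficients, this substitution is the Stirling transform
    [(S a)_n = sum_m a_m {n,m}_lambda], and the product of exponential
    generating functions is the binomial convolution [bconv].  So the heart of
    the matter is that [S] is multiplicative ([stirling_tr_bconv]).  Since [S]
    sends the falling factorials [(u)_k] to the degenerate ones, and both
    families turn addition of arguments into convolution (Vandermonde,
    [dfalling_vandermonde]), multiplicativity holds on falling factorial
    sequences; these are rich enough to force it for all sequences
    ([falling_free2]).

    As [S] maps [1 - x t] to [1 - x (e_lambda(t) - 1)], whose convolution inverse
    is the Fubini sequence, the relation [(1 - x t) * D = a] becomes
    [S D = S a * F], which is the claim ([stirling_tr_quotient]).

    Two analytic facts feed this computation.  First, an identity between
    functions near 0 gives the convolution identity between their coefficients
    ([is_egf_bconv]); this is read off from finite Taylor expansions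
    [f(t) = p(t) + O(t^N)], which avoids multiplying infinite series.  Secondly,
    [E[e_lambda^{-Y}(t)]] is the generating function of [a]
    ([is_egf_expectation_dexp]).  There expectation and sum are exchanged by
    dominated convergence: the partial sums of [e_lambda^y(t)] are at most
    [2 exp(eps |y|)] once [t] is small in terms of [eps]
    ([dexp_partial_le]), and [exp(eps |Y|)] is integrable for small [eps] because
    the moment generating function is finite near 0. *)

(** * Binomial convolution *)

Lemma natr_fact_neq0 {R : realType} k : k`!%:R != 0 :> R.
Proof. by rewrite pnatr_eq0 -lt0n fact_gt0. Qed.

Lemma sum_ord_widen {R : realType} (j n : nat) (f : nat -> R) : (j <= n)%N ->
  \sum_(l < j.+1) f l = \sum_(l < n.+1) if (l <= j)%N then f l else 0.
Proof.
by move=> jn; rewrite (big_ord_widen n.+1 f) ?ltnS// big_mkcond.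
Qed.

(** Coefficients of the product of two exponential generating functions. *)
Definition bconv {R : realType} (a b : nat -> R) (n : nat) : R :=
  \sum_(j < n.+1) 'C(n, j)%:R * a j * b (n - j)%N.

(** The coefficients of the constant function 1. *)
Definition bconv_unit {R : realType} (n : nat) : R := (n == 0%N)%:R.

Definition egf_poly {R : realType} (N : nat) (a : nat -> R) : {poly R} :=
  \poly_(i < N) (a i / i`!%:R).

(** Truncated generating polynomials turn [bconv] into multiplication of
    polynomials; its algebraic laws and its analytic meaning both come from
    here. *)
Lemma coef_egf_polyM {R : realType} (N n : nat) (a b : nat -> R) : (n < N)%N ->
  (egf_poly N a * egf_poly N b)`_n = bconv a b n / n`!%:R.
Proof.
move=> nN; rewrite coefM /bconv mulr_suml; apply: eq_bigr => -[j /= jn] _.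
rewrite ltnS in jn; rewrite !coef_poly (leq_ltn_trans jn nN).
rewrite (leq_ltn_trans (leq_subr _ _) nN).
have := bin_fact jn => /(congr1 (fun m : nat => m%:R : R)).
rewrite !natrM => h; rewrite -h.
have hj := @natr_fact_neq0 R j; have hn := @natr_fact_neq0 R (n - j).
have hb : 'C(n, j)%:R != 0 :> R by rewrite pnatr_eq0 -lt0n bin_gt0.
by field; rewrite hj hn hb.
Qed.

Lemma eq_bconv {R : realType} (a b a' b' : nat -> R) (n : nat) :
  (forall i, (i <= n)%N -> a i = a' i) -> (forall i, (i <= n)%N -> b i = b' i) ->
  bconv a b n = bconv a' b' n.
Proof.
move=> ha hb; apply: eq_bigr => -[j /= jn] _.
by rewrite ha// hb// leq_subr.
Qed.

Lemma bconvC {R : realType} (a b : nat -> R) (n : nat) :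
  bconv a b n = bconv b a n.
Proof.
apply: (mulIf (invr_neq0 (@natr_fact_neq0 R n))).
by rewrite -!(@coef_egf_polyM R n.+1)// mulrC.
Qed.

Lemma bconvA {R : realType} (a b c : nat -> R) (n : nat) :
  bconv a (bconv b c) n = bconv (bconv a b) c n.
Proof.
have conv_coef (u v w : nat -> R) :
    bconv (bconv u v) w n / n`!%:R =
    (egf_poly n.+1 u * egf_poly n.+1 v * egf_poly n.+1 w)`_n.
  rewrite -(@coef_egf_polyM R n.+1)// !coefM; apply: eq_bigr => j _.
  by rewrite coef_egf_polyM// coef_poly ltn_ord.
apply: (mulIf (invr_neq0 (@natr_fact_neq0 R n))).
by rewrite bconvC !conv_coef [_ * egf_poly _ a]mulrC mulrA.
Qed.

Lemma bconv1r {R : realType} (a : nat -> R) (n : nat) :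
  bconv a bconv_unit n = a n.
Proof.
rewrite /bconv big_ord_recr/= subnn /bconv_unit eqxx mulr1 binn mul1r.
rewrite big1 ?add0r// => -[j /= jn] _.
by rewrite subn_eq0 leqNgt jn mulr0.
Qed.

(** * Falling factorials *)

Lemma dfallingS {R : realType} (lambda x : R) k :
  dfalling lambda x k.+1 = dfalling lambda x k * (x - k%:R * lambda).
Proof. by rewrite /dfalling big_ord_recr. Qed.

(** The Vandermonde identity, that is [e^{x+y} = e^x e^y] for the degenerate
    exponential.  The induction splits the new factor as
    [x + y - n lambda = (x - j lambda) + (y - (n - j) lambda)] in the [j]-th
    summand. *)
Lemma dfalling_vandermonde {R : realType} (lambda x y : R) (n : nat) :
  dfalling lambda (x + y) n = bconv (dfalling lambda x) (dfalling lambda y) n.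
Proof.
elim: n => [|n IHn].
  by rewrite /bconv big_ord1 /dfalling !big_ord0 bin0 !mulr1.
rewrite dfallingS {}IHn /bconv.
transitivity (\sum_(j < n.+1) 'C(n, j)%:R *
    (dfalling lambda x j.+1 * dfalling lambda y (n - j)
   + dfalling lambda x j * dfalling lambda y (n.+1 - j))).
  rewrite mulr_suml; apply: eq_bigr => -[j /= jn] _.
  rewrite ltnS in jn; rewrite subSn// !dfallingS natrB//; ring.
(* Pascal's rule on the right-hand side recombines the two halves. *)
under eq_bigr do rewrite mulrDr !mulrA; rewrite big_split/=.
rewrite [RHS]big_ord_recl/= bin0 subn0.
under [in RHS]eq_bigr => i _ do
  rewrite /bump /= add1n subSS binS natrD mulrDl mulrDl.
rewrite big_split/= [X in _ = _ + (X + _)]big_ord_recr/=.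
rewrite bin_small// !mul0r addr0 [LHS]addrC addrA.
congr (_ + _).
by rewrite big_ord_recl/= bin0 subn0.
Qed.

Lemma fallingE {R : realType} (x : R) : falling x = dfalling 1 x.
Proof.
by apply/funext => k; apply: eq_bigr => i _; rewrite mulr1.
Qed.

Lemma falling_nat_small {R : realType} (m k : nat) : (m < k)%N ->
  falling (m%:R : R) k = 0.
Proof.
by move=> mk; rewrite /falling (bigD1 (Ordinal mk))//= subrr mul0r.
Qed.

Lemma falling_nat_diag_neq0 {R : realType} (k : nat) : falling (k%:R : R) k != 0.
Proof.
apply/prodf_neq0 => -[i /= ik] _.
by rewrite subr_eq0 eqr_nat; apply: contraTneq ik => ->; rewrite ltnn.
Qed.

(** Evaluation at [0, 1, 2, ...] gives a triangular system, as [(m)_k = 0] for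
    [m < k] and [(k)_k <> 0]. *)
Lemma falling_free {R : realType} (n : nat) (c : nat -> R) :
  (forall x, \sum_(k < n) c k * falling x k = 0) ->
  forall k, (k < n)%N -> c k = 0.
Proof.
move=> c0; elim/ltn_ind => k IHk kn.
have := c0 k%:R; rewrite (bigD1 (Ordinal kn))//= big1 ?addr0.
  by move/eqP; rewrite mulf_eq0 (negbTE (falling_nat_diag_neq0 k)) orbF => /eqP.
move=> [i /= ilt]; rewrite -val_eqE/= => ik.
case: (ltngtP i k) ik => [lt_ik _|lt_ki _|//].
  by rewrite IHk// mul0r.
by rewrite falling_nat_small// mulr0.
Qed.

Lemma falling_free2 {R : realType} (n : nat) (c : nat -> nat -> R) :
  (forall x y,
    \sum_(l < n) \sum_(k < n) c l k * falling x l * falling y k = 0) ->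
  forall l k, (l < n)%N -> (k < n)%N -> c l k = 0.
Proof.
move=> c0 l k ln kn.
apply: (@falling_free _ n (c l)) kn => y.
apply: (@falling_free _ n
  (fun i => \sum_(k < n) c i k * falling y k)) ln => x.
rewrite -[RHS](c0 x y); apply: eq_bigr => i _; rewrite mulr_suml.
by apply: eq_bigr => j _; rewrite mulrAC.
Qed.

(** * The Stirling transform *)

(** On exponential generating functions this is the substitution of
    [e_lambda(t) - 1] for [t]. *)
Definition stirling_tr {R : realType} (St : nat -> nat -> R) (a : nat -> R)
  (n : nat) : R := \sum_(m < n.+1) a m * St n m.

(** This bilinear form, and the one of [bconv_stirling_trE], need only be known to
    exist: [stirling_tr_bconv] identifies their coefficients by testing on
    falling factorials. *)
Lemma stirling_tr_bconvE {R : realType} (St : nat -> nat -> R) (n : nat) :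
  exists c : nat -> nat -> R, forall a b, stirling_tr St (bconv a b) n =
    \sum_(l < n.+1) \sum_(k < n.+1) c l k * a l * b k.
Proof.
exists (fun l k => \sum_(m < n.+1) if (l + k == m)%N then 'C(m, l)%:R * St n m
                                   else 0) => a b.
under [RHS]eq_bigr do under eq_bigr do rewrite !mulr_suml.
under [RHS]eq_bigr do rewrite exchange_big/=.
rewrite [RHS]exchange_big/=; apply: eq_bigr => -[m /= mn] _.
rewrite ltnS in mn.
rewrite /bconv
  (sum_ord_widen (fun l => 'C(m, l)%:R * a l * b (m - l)%N) mn) mulr_suml.
apply: eq_bigr => -[l /= ln] _; case: ifPn => lm.
  have kn : (m - l < n.+1)%N by rewrite ltnS (leq_trans (leq_subr _ _)).
  rewrite (bigD1 (Ordinal kn))//= subnKC// eqxx big1 ?addr0; first by ring.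
  move=> [k /= klt]; rewrite -val_eqE/= => km.
  case: eqP => [h|_]; last by rewrite !mul0r.
  by rewrite -h addKn eqxx in km.
rewrite mul0r big1// => k _; case: eqP => [h|_]; last by rewrite !mul0r.
by rewrite -h leq_addr in lm.
Qed.

Lemma bconv_stirling_trE {R : realType} (St : nat -> nat -> R) (n : nat) :
  exists c : nat -> nat -> R, forall a b,
    bconv (stirling_tr St a) (stirling_tr St b) n =
    \sum_(l < n.+1) \sum_(k < n.+1) c l k * a l * b k.
Proof.
(* [St j l] is arbitrary for [l > j]; [s] sets it to 0 there. *)
pose s j l := if (l <= j)%N then St j l else 0.
have trE a j : (j <= n)%N ->
    stirling_tr St a j = \sum_(l < n.+1) a l * s j l.
  move=> jn; rewrite /stirling_tr (sum_ord_widen (fun m => a m * St j m) jn).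
  by apply: eq_bigr => l _; rewrite /s; case: ifP => _ //; rewrite mulr0.
exists (fun l k => \sum_(j < n.+1) 'C(n, j)%:R * s j l * s (n - j)%N k) => a b.
under [RHS]eq_bigr do under eq_bigr do rewrite !mulr_suml.
under [RHS]eq_bigr do rewrite exchange_big/=.
rewrite [RHS]exchange_big/=; apply: eq_bigr => -[j /= jn] _.
rewrite !trE ?leq_subr// -mulrA mulr_suml mulr_sumr; apply: eq_bigr => l _.
rewrite mulr_sumr mulr_sumr; apply: eq_bigr => k _; ring.
Qed.

Lemma stirling_tr_falling {R : realType} (lambda : R) (St : nat -> nat -> R)
    (x : R) (n : nat) : is_degenerate_stirling2 lambda St ->
  stirling_tr St (falling x) n = dfalling lambda x n.
Proof. by move=> ->; apply: eq_bigr => k _; rewrite mulrC. Qed.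

(** Both sides are bilinear in [a] and [b] with finitely many coefficients, and
    they agree on falling factorials by the Vandermonde identity for
    [lambda] and for 1. *)
Lemma stirling_tr_bconv {R : realType} (lambda : R) (St : nat -> nat -> R)
    (a b : nat -> R) (n : nat) : is_degenerate_stirling2 lambda St ->
  stirling_tr St (bconv a b) n = bconv (stirling_tr St a) (stirling_tr St b) n.
Proof.
move=> defS.
have [c1 c1E] := stirling_tr_bconvE St n.
have [c2 c2E] := bconv_stirling_trE St n.
rewrite c1E c2E; apply: eq_bigr => l _; apply: eq_bigr => k _.
congr (_ * _ * _); apply/eqP; rewrite -subr_eq0; apply/eqP.
apply: (@falling_free2 _ n.+1 (fun l k => c1 l k - c2 l k)) => // x y.
have : stirling_tr St (bconv (falling x) (falling y)) n
     = bconv (stirling_tr St (falling x)) (stirling_tr St (falling y)) n.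
  have -> : bconv (falling x) (falling y) = falling (x + y).
    by apply/funext => m; rewrite !fallingE dfalling_vandermonde.
  rewrite (stirling_tr_falling _ _ defS) dfalling_vandermonde.
  by apply: eq_bconv => i _; rewrite (stirling_tr_falling _ _ defS).
rewrite c1E c2E => /eqP; rewrite -subr_eq0 -sumrB => /eqP h.
rewrite -[RHS]h. apply: eq_bigr => i _; rewrite -sumrB; apply: eq_bigr => j _.
by rewrite !mulrBl.
Qed.

Lemma stirling2_0 {R : realType} (lambda : R) (St : nat -> nat -> R) (n : nat) :
  is_degenerate_stirling2 lambda St -> St n 0%N = bconv_unit n.
Proof.
move=> defS; have := defS n 0; rewrite big_ord_recl/= big1 ?addr0.
  rewrite /falling big_ord0 mulr1 => <-.
  case: n => [|n]; rewrite /dfalling /bconv_unit ?big_ord0//.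
  by rewrite big_ord_recl/= mul0r subr0 mul0r.
by move=> i _; rewrite (@falling_nat_small R 0) ?mulr0.
Qed.

Lemma stirling2_1 {R : realType} (lambda : R) (St : nat -> nat -> R) (n : nat) :
  is_degenerate_stirling2 lambda St ->
  St n.+1 1%N = dfalling lambda 1 n.+1.
Proof.
move=> defS; have := defS n.+1 1; rewrite big_ord_recl (stirling2_0 _ defS).
rewrite /bconv_unit mul0r add0r big_ord_recl/= /bump/= /falling big_ord1.
rewrite subr0 mulr1 big1 ?addr0 => [->//|i _].
by rewrite !big_ord_recl/= /bump/= subrr mul0r mulr0 mulr0.
Qed.

(** The coefficients of [1 - x t]. *)
Definition linear_coef {R : realType} (x : R) (n : nat) : R :=
  bconv_unit n - x * (n == 1%N)%:R.

(** The coefficients of [1 - x (e_lambda(t) - 1)]. *)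
Definition fubini_denom {R : realType} (lambda x : R) (n : nat) : R :=
  bconv_unit n - x * (dfalling lambda 1 n - bconv_unit n).

Lemma stirling_tr_linear {R : realType} (lambda : R) (St : nat -> nat -> R)
    (x : R) (n : nat) : is_degenerate_stirling2 lambda St ->
  stirling_tr St (linear_coef x) n = fubini_denom lambda x n.
Proof.
move=> defS; rewrite /stirling_tr /linear_coef /fubini_denom big_ord_recl/=.
rewrite (stirling2_0 _ defS) /bconv_unit mulr0 subr0 mul1r.
case: n => [|n].
  by rewrite big_ord0 /dfalling big_ord0 subrr mulr0 subr0 addr0.
rewrite big_ord_recl/= /bump/= (stirling2_1 _ defS) big1 ?addr0.
  by rewrite subr0; ring.
by move=> i _; rewrite /= mulr0 subrr mul0r.
Qed.

(** The transform of [linear_coef x * D = a] is [S D * c = S a], where [c] is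
    [fubini_denom]; then convolve with [F], the inverse of [c]. *)
Lemma stirling_tr_quotient {R : realType} (lambda x : R) (St : nat -> nat -> R)
    (a D F : nat -> R) (n : nat) : is_degenerate_stirling2 lambda St ->
  (forall k, bconv (linear_coef x) D k = a k) ->
  (forall k, bconv (fubini_denom lambda x) F k = bconv_unit k) ->
  stirling_tr St D n = bconv (stirling_tr St a) F n.
Proof.
move=> defS Da F1; set tD := stirling_tr St D.
have tDa k : bconv tD (fubini_denom lambda x) k = stirling_tr St a k.
  rewrite bconvC; under [RHS]eq_bigr do rewrite -Da.
  rewrite -/(stirling_tr St _ _) (stirling_tr_bconv _ _ _ defS).
  by apply: eq_bconv => // i _; rewrite (stirling_tr_linear _ _ defS).
rewrite -[tD n]bconv1r.
transitivity (bconv tD (bconv (fubini_denom lambda x) F) n).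
  by apply: eq_bconv => // i _; rewrite F1.
by rewrite bconvA; apply: eq_bconv => // i _; rewrite tDa.
Qed.

(** * Coefficients of exponential generating functions *)

(** The Taylor expansion [f(t) = p(t) + O(t^N)] at 0.  Finite expansions can be
    multiplied without any rearrangement of series, yet they still determine
    the first [N] coefficients. *)
Definition near_poly {R : realType} (f : R -> R) (p : {poly R}) (N : nat) :=
  exists C, \forall t \near (0 : R), `|f t - p.[t]| <= C * `|t| ^+ N.

(** The bound forces [p] to vanish at 0, and then it passes to [p / X] with
    exponent [N - 1].  Dividing by [t] is why the neighbourhood is punctured. *)
Lemma poly_small_coef0 {R : realType} (N : nat) (C : R) (p : {poly R}) :
  (\forall t \near (0 : R)^', `|p.[t]| <= C * `|t| ^+ N) ->
  forall k, (k < N)%N -> p`_k = 0.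
Proof.
elim: N p => [//|N IHN] p small.
have p0 : p`_0 = 0.
  rewrite -horner_coef0; apply/eqP; rewrite -normr_le0.
  (* Let [t] tend to 0 on both sides of the bound. *)
  have pC : `|p.[t]| @[t --> (0 : R)^'] --> `|p.[0]|.
    by apply: cvg_norm; apply: cvg_within_filter; exact: continuous_horner.
  have bC : (C *: 'X^(N.+1)).[`|t|] @[t --> (0 : R)^'] -->
            (C *: 'X^(N.+1)).[`|0 : R|].
    apply: continuous_cvg; first exact: continuous_horner.
    by apply: cvg_norm; apply: cvg_within_filter; exact: cvg_id.
  have b0 : (C *: 'X^(N.+1)).[0] = 0 :> R by rewrite !hornerE expr0n mulr0.
  rewrite normr0 b0 in bC.
  apply: (ler_cvg_to pC bC); apply: filterS small => t.
  by rewrite !hornerE.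
case=> [//|k] kN; rewrite -addn1 -coef_drop_poly; apply: IHN => //.
have nz : \forall t \near (0 : R)^', t != 0 by exact: nbhs_dnbhs_neq.
apply: filterS2 small nz => t.
have -> : p.[t] = (drop_poly 1 p).[t] * t.
  rewrite -{1}(poly_take_drop 1 p) hornerD hornerM hornerXn expr1.
  rewrite [take_poly 1 p](_ : _ = 0) ?horner0 ?add0r//.
  apply/polyP => i; rewrite coef_take_poly coef0.
  by case: i => [|i] //=; rewrite p0.
by rewrite normrM exprSr mulrA -normr_gt0 => + t0; rewrite ler_pM2r.
Qed.

Lemma near_poly_uniq {R : realType} (N k : nat) (f : R -> R) (p q : {poly R}) :
  near_poly f p N -> near_poly f q N -> (k < N)%N -> p`_k = q`_k.
Proof.
move=> [C1 h1] [C2 h2] kN; apply/eqP; rewrite -subr_eq0 -coefB; apply/eqP.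
apply: (@poly_small_coef0 _ N (C1 + C2)) kN; apply: nbhs_dnbhs.
apply: filterS2 h1 h2 => t h1 h2; rewrite hornerD hornerN mulrDl.
have -> : p.[t] - q.[t] = (f t - q.[t]) - (f t - p.[t]) by ring.
by rewrite (le_trans (ler_normB _ _))// addrC lerD.
Qed.

Lemma near_polyM {R : realType} (N : nat) (f g : R -> R) (p q : {poly R}) :
  near_poly f p N -> near_poly g q N ->
  near_poly (fun t => f t * g t) (p * q) N.
Proof.
move=> [C1 h1] [C2 h2].
have bnd (r : {poly R}) : exists B, \forall t \near (0 : R), `|r.[t]| <= B.
  exists (`|r.[0]| + 1).
  by apply: (cvgr_norm_le _ (@continuous_horner _ r 0)); rewrite ltrDl.
have le1 : \forall t \near (0 : R), `|t| <= 1 by exact: nbhs0_le.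
have [[Bp hBp] [Bq hBq]] := (bnd p, bnd q).
exists (`|C1| * `|C2| + Bp * `|C2| + `|C1| * Bq).
near=> t.
have k1 : `|f t - p.[t]| <= `|C1| * `|t| ^+ N.
  apply: le_trans (_ : C1 * `|t| ^+ N <= _); first by near: t.
  by rewrite ler_wpM2r ?exprn_ge0// ler_norm.
have k2 : `|g t - q.[t]| <= `|C2| * `|t| ^+ N.
  apply: le_trans (_ : C2 * `|t| ^+ N <= _); first by near: t.
  by rewrite ler_wpM2r ?exprn_ge0// ler_norm.
have k2' : `|g t - q.[t]| <= `|C2|.
  apply: (le_trans k2); rewrite ler_piMr// exprn_ile1//.
have hp : `|p.[t]| <= Bp by near: t.
have hq : `|q.[t]| <= Bq by near: t.
rewrite hornerM.
(* Each summand below has a factor of order [t^N], the other factor being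
   bounded. *)
have -> : f t * g t - p.[t] * q.[t] = (f t - p.[t]) * (g t - q.[t])
    + p.[t] * (g t - q.[t]) + (f t - p.[t]) * q.[t] by ring.
move: (f t - _) (g t - _) k1 k2 k2' => u v k1 k2 k2'.
rewrite !mulrDl; apply: (le_trans (ler_normD _ _)); apply: lerD.
  apply: (le_trans (ler_normD _ _)); apply: lerD.
    by rewrite normrM mulrAC ler_pM.
  by rewrite normrM -mulrA ler_pM.
by rewrite normrM mulrAC ler_pM.
Unshelve. all: by end_near. Qed.

(** With [s] inside the disc of convergence, the tail beyond [N] is at most
    [(|t| / s)^N] times the sum of the absolute series at [s]. *)
Lemma is_egf_near_poly {R : realType} (f : R -> R) (a : nat -> R) (N : nat) :
  is_egf f a -> near_poly f (egf_poly N a) N.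
Proof.
move=> fa; have [e /= e0 cvgf] : exists2 e : R, 0 < e & forall t, `|t| < e ->
    (pseries (fun n => a n / n`!%:R) t @ \oo --> f t)%classic.
  have /nbhs_ballP[e e0 h] := fa; exists e => // t te.
  by apply: h; rewrite /ball/= sub0r normrN.
(* The series converges at [e / 2], hence absolutely at the smaller [s]. *)
pose s := e / 4; have s0 : 0 < s by rewrite divr_gt0.
pose c n := a n / n`!%:R.
have cvgs : cvgn (pseries (fun n => `|c n|) s).
  apply: (@is_cvg_pseries_inside_norm _ _ (e / 2)).
    apply/cvg_ex; exists (f (e / 2)); apply: cvgf.
    by rewrite gtr0_norm ?divr_gt0// /s; lra.
  by rewrite !gtr0_norm ?divr_gt0// /s; lra.
pose M := limn (pseries (fun n => `|c n|) s).
have les : \forall t \near (0 : R), `|t| <= s by exact: nbhs0_le.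
exists (M / s ^+ N); near=> t.
have ts : `|t| <= s by near: t.
have fcvg : (pseries c t n - (egf_poly N a).[t] @[n --> \oo] -->
             f t - (egf_poly N a).[t])%classic.
  apply: cvgB; last exact: cvg_cst.
  by apply: cvgf; rewrite (le_lt_trans ts)// /s; lra.
apply: (cvgr_to_le (cvg_norm fcvg)); near=> n.
have Nn : (N <= n)%N by near: n; exact: nbhs_infty_ge.
rewrite [(egf_poly N a).[t]](_ : _ = pseries c t N); last first.
  by rewrite horner_poly /pseries /series/= big_mkord.
rewrite /pseries sub_series_geq//.
apply: le_trans (_ : \sum_(N <= k < n) `|c k| * s ^+ k * (`|t| ^+ N / s ^+ N) <= _).
  rewrite (le_trans (ler_norm_sum _ _ _))//; apply: ler_sum_nat => k /andP[Nk _].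
  rewrite normrM normrX -mulrA ler_wpM2l//.
  have sN : s ^+ N != 0 by rewrite expf_neq0// gt_eqF.
  have -> : s ^+ k * (`|t| ^+ N / s ^+ N) = s ^+ (k - N) * `|t| ^+ N.
    by rewrite -{1}(subnK Nk) exprD; field.
  by rewrite -{1}(subnK Nk) exprD ler_wpM2r ?exprn_ge0// lerXn2r// nnegrE// ltW.
rewrite -mulr_suml [leRHS]mulrAC -[leRHS]mulrA.
rewrite ler_wpM2r// ?mulr_ge0 ?invr_ge0 ?exprn_ge0 ?(ltW s0)//.
apply: le_trans (_ : pseries (fun n => `|c n|) s n <= _).
  rewrite /pseries -sub_series_geq// lerBlDr lerDl /series/= sumr_ge0// => i _.
  by rewrite mulr_ge0// exprn_ge0// ltW.
apply: nondecreasing_cvgn_le => //; apply/nondecreasing_seqP => m.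
by rewrite /pseries /series/= big_nat_recr//= lerDl mulr_ge0// exprn_ge0// ltW.
Unshelve. all: by end_near. Qed.

(** Both sides have the same Taylor polynomial of degree [n]. *)
Lemma is_egf_bconv {R : realType} (f g h : R -> R) (a b c : nat -> R) (n : nat) :
  is_egf f a -> is_egf g b -> is_egf h c ->
  (\forall t \near (0 : R), h t = f t * g t) -> c n = bconv a b n.
Proof.
move=> fa gb hc hfg; apply: (mulIf (invr_neq0 (@natr_fact_neq0 R n))).
rewrite -(@coef_egf_polyM R n.+1)//.
have := near_polyM (is_egf_near_poly n.+1 fa) (is_egf_near_poly n.+1 gb).
have [C hC] := is_egf_near_poly n.+1 hc.
move=> fgp; rewrite -(@near_poly_uniq _ n.+1 n _ (egf_poly n.+1 c) _ _ fgp)//.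
  by rewrite coef_poly ltnSn.
by exists C; apply: filterS2 hC hfg => t + <-.
Qed.

Lemma is_egf_neq0 {R : realType} (f : R -> R) (a : nat -> R) :
  is_egf f a -> a 0%N != 0 -> \forall t \near (0 : R), f t != 0.
Proof.
move=> /(is_egf_near_poly 1)[C hC] a0.
have C1 : 0 < `|C| + 1 by rewrite ltr_wpDl.
have r0 : 0 < `|a 0%N| / (`|C| + 1) by rewrite divr_gt0// normr_gt0.
have ltr : \forall t \near (0 : R), `|t| < `|a 0%N| / (`|C| + 1).
  exact: nbhs0_lt.
apply: filterS2 hC ltr => t hC; rewrite ltr_pdivlMr// => ltr.
apply: contraTneq ltr => ft0; rewrite -leNgt.
move: hC; rewrite ft0 horner_poly big_ord1 fact0 divr1 expr0 mulr1 expr1 sub0r.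
rewrite normrN => /le_trans; apply; rewrite mulrC ler_wpM2l//.
by rewrite (le_trans (ler_norm _))// lerDl.
Qed.

(** The form in which the derangement and Fubini generating functions are
    used: the denominator is cleared near 0, where it does not vanish. *)
Lemma is_egf_quotient {R : realType} (g h : R -> R) (a b c : nat -> R) (n : nat) :
  is_egf g b -> b 0%N != 0 -> is_egf h a ->
  is_egf (fun t => (g t)^-1 * h t) c -> bconv b c n = a n.
Proof.
move=> gb b0 ha hc; rewrite -(is_egf_bconv n gb hc ha)//.
by apply: filterS (is_egf_neq0 gb b0) => t gt0; rewrite mulrA mulfV// mul1r.
Qed.

Lemma is_egf_lincomb {R : realType} (f g : R -> R) (a b : nat -> R) (k : R) :
  is_egf f a -> is_egf g b ->
  is_egf (fun t => f t - k * g t) (fun n => a n - k * b n).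
Proof.
move=> fa gb; apply: filterS2 fa gb => t fa gb.
rewrite [X in (X @ _ --> _)%classic](_ : _ =
    (fun n => pseries (fun n => a n / n`!%:R) t n
            - k * pseries (fun n => b n / n`!%:R) t n)).
  by apply: cvgB => //; apply: cvgMr.
apply/funext => n; rewrite /pseries /series/= mulr_sumr -sumrB.
by apply: eq_bigr => i _; ring.
Qed.

Lemma is_egf_monomial {R : realType} (m : nat) :
  is_egf (fun t : R => t ^+ m / m`!%:R) (fun n => (n == m)%:R).
Proof.
rewrite /is_egf; near=> t; apply: cvg_near_cst; near=> n.
rewrite /pseries /series/= big_mkord.
have mn : (m < n)%N by near: n; exact: nbhs_infty_gt.
rewrite (bigD1 (Ordinal mn))//= eqxx big1 ?addr0; first by rewrite mulrC mulrA mulr1.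
by move=> i; rewrite -val_eqE/= => /negbTE ->; rewrite !mul0r.
Unshelve. all: by end_near. Qed.

(** * The degenerate exponential of a random variable *)

Lemma expRn_le_fact {R : realType} (w : R) (k : nat) : 0 <= w ->
  w ^+ k <= k`!%:R * expR w.
Proof.
move=> w0; case: k => [|k]; first by rewrite expr0 fact0 mul1r -{1}expR0 ler_expR.
have k0 : 0 < (k.+1)`!%:R :> R by rewrite ltr0n fact_gt0.
rewrite -ler_pdivrMl// mulrC (le_trans _ (expR_ge1Dxn k w0))//.
by rewrite lerDr.
Qed.

(** The inverse of a lower bound for the radius of convergence: the terms of
    [e_lambda^y(t)] grow at most like its powers times [exp (eps |y|) |t|^k]. *)
Definition dfalling_rate {R : realType} (lambda eps : R) : R :=
  expR (eps * `|lambda|) / eps.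

Lemma dfalling_rate_gt0 {R : realType} (lambda eps : R) :
  0 < eps -> 0 < dfalling_rate lambda eps.
Proof. by move=> e0; rewrite divr_gt0// expR_gt0. Qed.

(** Each factor is at most [w = |y| + k |lambda|], and
    [(eps w)^k <= k! exp(eps w)].  The dependence on [y] is thus confined to
    [exp(eps |y|)] with [eps] as small as desired, which a finite moment
    generating function can absorb. *)
Lemma dfalling_le {R : realType} (lambda y eps : R) (k : nat) : 0 < eps ->
  `|dfalling lambda y k| <=
    k`!%:R * dfalling_rate lambda eps ^+ k * expR (eps * `|y|).
Proof.
move=> e0.
apply: (@le_trans _ _ ((`|y| + k%:R * `|lambda|) ^+ k)).
  rewrite /dfalling normr_prod -[X in _ <= _ ^+ X]card_ord -prodr_const.
  apply: ler_prod => i _; rewrite normr_ge0/= (le_trans (ler_normB _ _))//.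
  by rewrite normrM ger0_norm// lerD2l ler_wpM2r// ler_nat ltnW.
have w0 : 0 <= eps * (`|y| + k%:R * `|lambda|).
  by rewrite mulr_ge0 ?(ltW e0)// addr_ge0// mulr_ge0.
have := expRn_le_fact k w0; rewrite exprMn mulrC -ler_pdivlMr ?exprn_gt0//.
move=> /le_trans; apply.
have -> : expR (eps * (`|y| + k%:R * `|lambda|)) =
    expR (eps * `|y|) * expR (eps * `|lambda|) ^+ k.
  by rewrite mulrDr expRD -expRM_natl mulrCA.
rewrite /dfalling_rate expr_div_n.
by rewrite le_eqVlt; apply/orP; left; apply/eqP; ring.
Qed.

Lemma dfalling_term_le {R : realType} (lambda y eps t : R) (k : nat) : 0 < eps ->
  `|t| <= (dfalling_rate lambda eps)^-1 / 2 ->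
  `|dfalling lambda y k / k`!%:R * t ^+ k| <=
    geometric (expR (eps * `|y|)) (2^-1) k.
Proof.
move=> e0 ht; have r0 := dfalling_rate_gt0 lambda e0.
rewrite normrM normrX normrM normfV (@ger0_norm _ k`!%:R)//.
apply: (@le_trans _ _ (dfalling_rate lambda eps ^+ k * expR (eps * `|y|) *
    ((dfalling_rate lambda eps)^-1 / 2) ^+ k)).
  apply: ler_pM => //.
    rewrite ler_pdivrMr ?ltr0n ?fact_gt0// (le_trans (dfalling_le _ _ _ e0))//.
    by rewrite -mulrA mulrC.

  by rewrite lerXn2r// nnegrE// divr_ge0// invr_ge0 ltW.
have rk : dfalling_rate lambda eps ^+ k != 0 by rewrite expf_neq0// gt_eqF.
rewrite /geometric/=; move: (dfalling_rate _ _) rk => r rk.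
by rewrite exprMn exprVn -mulrA mulrCA mulVKf.
Qed.

Lemma cvg_dexp {R : realType} (lambda y eps t : R) : 0 < eps ->
  `|t| <= (dfalling_rate lambda eps)^-1 / 2 ->
  pseries (fun k => dfalling lambda y k / k`!%:R) t @ \oo --> dexp lambda y t.
Proof.
move=> e0 ht; apply: normed_cvg.
apply: (@series_le_cvg _ _ (geometric (expR (eps * `|y|)) (2^-1))).
- by move=> n /=.
- by move=> n; apply: geometric_ge0; rewrite ?expR_ge0.
- by move=> n; apply: dfalling_term_le.
- by apply: is_cvg_geometric_series; rewrite gtr0_norm; lra.
Qed.

Lemma dexp_partial_le {R : realType} (lambda y eps t : R) (n : nat) : 0 < eps ->
  `|t| <= (dfalling_rate lambda eps)^-1 / 2 ->
  `|pseries (fun k => dfalling lambda y k / k`!%:R) t n| <=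
    2 * expR (eps * `|y|).
Proof.
move=> e0 ht; rewrite /pseries /series/=.
apply: (le_trans (ler_norm_sum _ _ _)).
apply: (@le_trans _ _ (series (geometric (expR (eps * `|y|)) (2^-1)) n)).
  by apply: ler_sum => i _; apply: dfalling_term_le.
apply: (le_trans (geometric_le_lim _ _ _ _)); rewrite ?expR_ge0//.
  by rewrite gtr0_norm; lra.
by rewrite le_eqVlt; apply/orP; left; apply/eqP; field.
Qed.

Lemma near0_dfalling_rate {R : realType} (lambda eps : R) : 0 < eps ->
  \forall t \near (0 : R), `|t| <= (dfalling_rate lambda eps)^-1 / 2.
Proof.
by move=> e0; apply: nbhs0_le; rewrite divr_gt0// invr_gt0 dfalling_rate_gt0.
Qed.

Lemma measurable_dfalling d (T : measurableType d) (R : realType)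
    (Z : T -> R) (lambda : R) (k : nat) : measurable_fun setT Z ->
  measurable_fun setT (fun w => dfalling lambda (Z w) k).
Proof.
move=> mZ; apply: measurable_prod => i _.
by apply: measurable_funB => //; exact: measurable_cst.
Qed.

Lemma integrable_dfalling d (T : measurableType d) (R : realType)
    (P : probability T R) (Z : T -> R) (lambda eps : R) (k : nat) :
  0 < eps -> measurable_fun setT Z ->
  P.-integrable setT (fun w => (expR (eps * `|Z w|))%:E) ->
  P.-integrable setT (fun w => (dfalling lambda (Z w) k)%:E).
Proof.
move=> e0 mZ iZ.
apply: (le_integrable measurableT _ _
  (integrableZl measurableT (k`!%:R * dfalling_rate lambda eps ^+ k) iZ)).
  by apply/measurable_EFinP; exact: measurable_dfalling.
move=> w _; rewrite /= lee_fin [leRHS]ger0_norm; first exact: dfalling_le.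
rewrite mulr_ge0 ?expR_ge0// mulr_ge0// exprn_ge0//.
exact/ltW/dfalling_rate_gt0.
Qed.

(** Dominated convergence for the partial sums of [e_lambda^Z(t)], with
    the dominating function [2 exp(eps |Z|)]. *)
Lemma is_egf_expectation_dexp d (T : measurableType d) (R : realType)
    (P : probability T R) (Z : T -> R) (lambda eps : R) :
  0 < eps -> measurable_fun setT Z ->
  P.-integrable setT (fun w => (expR (eps * `|Z w|))%:E) ->
  is_egf (fun t => fine 'E_P[fun w => dexp lambda (Z w) t])
         (fun k => fine 'E_P[fun w => dfalling lambda (Z w) k]).
Proof.
move=> e0 mZ iZ; rewrite unlock; apply: filterS (near0_dfalling_rate lambda e0) => t ht.
have iD k := integrable_dfalling lambda k e0 mZ iZ.
pose S n w := pseries (fun k => dfalling lambda (Z w) k / k`!%:R) t n.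
have ES n : (\int[P]_w (S n w)%:E = (pseries (fun k =>
    fine (\int[P]_w (dfalling lambda (Z w) k)%:E) / k`!%:R) t n)%:E)%E.
  rewrite /S /pseries /series/=.
  under eq_integral do rewrite -sumEFin.
  pose c k := k`!%:R^-1 * t ^+ k.
  rewrite integral_sum//; last first.
    move=> k; apply: eq_integrable (integrableZl measurableT (c k) (iD k)) => //.
    by move=> w _; rewrite /= -EFinM /c mulrC mulrA.
  rewrite -sumEFin; apply: eq_bigr => k _.
  rewrite -mulrA EFinM fineK ?integrable_fin_num//.
  by rewrite -integralZr//; apply: eq_integral => w _; rewrite -EFinM mulrA.
have mS n : measurable_fun setT (S n).
  apply: measurable_sum => k.
  apply: measurable_funM; last exact: measurable_cst.
  apply: measurable_funM; last exact: measurable_cst.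
  exact: measurable_dfalling.
have cvgS w : S n w @[n --> \oo] --> dexp lambda (Z w) t.
  exact: (cvg_dexp e0 ht).
have mE : measurable_fun setT (fun w => dexp lambda (Z w) t).
  by apply: (measurable_fun_cvg mS) => w _.
have [] := @dominated_convergence _ _ _ P _ measurableT
  (fun n w => (S n w)%:E) (fun w => (dexp lambda (Z w) t)%:E)
  (fun w => (2 * expR (eps * `|Z w|))%:E).
- by move=> n; exact/measurable_EFinP.
- exact/measurable_EFinP.
- by apply: aeW => w _; apply/fine_cvgP; split; [exact: nearW|exact: cvgS].
- by under eq_fun do rewrite EFinM; exact: integrableZl.
- by apply: aeW => w n _; rewrite lee_fin; apply: dexp_partial_le.
move=> iE _ /=; under eq_cvg do rewrite ES.
rewrite -{1}(fineK (integrable_fin_num measurableT iE)).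
exact: fine_cvg.
Qed.

(** [exp(eps |Y|) <= exp(eps Y) + exp(- eps Y)]. *)
Lemma mgf_integrable_expR_norm d (T : measurableType d) (R : realType)
    (P : probability T R) (Y : {RV P >-> R}) : has_mgf Y ->
  exists2 eps : R, 0 < eps &
    P.-integrable setT (fun w => (expR (eps * `|Y w|))%:E).
Proof.
move=> [r r0 mgf]; exists (r / 2); first by rewrite divr_gt0.
have mY (c : R) : measurable_fun setT (fun w => expR (c * Y w)).
  by apply: measurableT_comp => //; apply: measurable_funM.
have iY (c : R) : `|c| < r -> P.-integrable setT (fun w => (expR (c * Y w))%:E).
  move=> /mgf cr; apply/integrableP; split; first exact/measurable_EFinP.
  move: cr; rewrite /mmt_gen_fun unlock; congr (_ < _)%E.
  by apply: eq_integral => w _ /=; rewrite ger0_norm ?expR_ge0// mulrC.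
have hr : `|r / 2| < r by rewrite gtr0_norm ?divr_gt0//; lra.
have hr' : `|- (r / 2)| < r by rewrite normrN.
apply: (le_integrable measurableT _ _
  (integrableD measurableT (iY _ hr) (iY _ hr'))).
  apply/measurable_EFinP; apply: measurableT_comp => //.
  by apply: measurable_funM => //; apply: measurableT_comp.
move=> w _; rewrite /= lee_fin ger0_norm ?expR_ge0//.
rewrite [leRHS]ger0_norm ?addr_ge0 ?expR_ge0//.
case: (ler0P (Y w)) => _; first by rewrite mulrN mulNr lerDr expR_ge0.
by rewrite lerDl expR_ge0.
Qed.

Lemma dfallingN {R : realType} (lambda y : R) (k : nat) :
  dfalling lambda (- y) k = (-1) ^+ k * drising lambda y k.
Proof.
rewrite /dfalling /drising -[X in _ ^+ X]card_ord -prodr_const -big_split/=.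
by apply: eq_bigr => i _; ring.
Qed.

(** * The identity for the derangement polynomials *)

Theorem theorem2p11 (R : realType) (d : measure_display)
    (T : measurableType d) (P : probability T R) (Y : {RV P >-> R})
    (lambda : R) (St : nat -> nat -> R) (F D : nat -> R -> R)
    (lambda_neq0 : lambda != 0)
    (mgfY : has_mgf Y)
    (defS : is_degenerate_stirling2 lambda St)
    (defF : is_degenerate_fubini lambda F)
    (defD : is_prob_derangement2 Y lambda D)
    (x : R) (n : nat) :
  \sum_(m < n.+1) D m x * St n m =
  \sum_(j < n.+1) \sum_(l < j.+1)
    (-1) ^+ l * 'C(n, j)%:R * fine 'E_P[fun w => drising lambda (Y w) l]
      * St j l * F (n - j)%N x.
Proof.
pose Z w := - Y w.
have [eps e0 iY] := mgf_integrable_expR_norm mgfY.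
have mZ : measurable_fun setT Z by exact: measurableT_comp.
have iZ : P.-integrable setT (fun w => (expR (eps * `|Z w|))%:E).
  by apply: eq_integrable iY => // w _; rewrite /Z normrN.
pose a l := fine 'E_P[fun w => dfalling lambda (Z w) l].
have aE l : a l = (-1) ^+ l * fine 'E_P[fun w => drising lambda (Y w) l].
  rewrite /a.
  have iD := integrable_dfalling lambda l e0 mZ iZ.
  have -> : (fun w => drising lambda (Y w) l) =
            (fun w => (-1) ^+ l * dfalling lambda (Z w) l).
    by apply/funext => w; rewrite /Z dfallingN signrMK.
  rewrite unlock; under [in RHS]eq_integral do rewrite EFinM.
  rewrite integralZl// fineM// ?integrable_fin_num//.
  by rewrite signrMK.
have Ea : is_egf (fun t => fine 'E_P[fun w => dexp lambda (Z w) t]) a.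
  exact: (is_egf_expectation_dexp lambda e0 mZ iZ).
have one : is_egf (fun=> 1 : R) bconv_unit.
  by apply: filterS (is_egf_monomial 0) => t; rewrite expr0 fact0 divr1.
have linE : is_egf (fun t => 1 - x * t) (linear_coef x).
  apply: (is_egf_lincomb x one).
  by apply: filterS (is_egf_monomial 1) => t; rewrite expr1 divr1.
have dexpE : is_egf (dexp lambda 1) (dfalling lambda 1).
  apply: filterS (near0_dfalling_rate lambda ltr01) => t.
  exact: (cvg_dexp ltr01).
have fubE : is_egf (fun t => 1 - x * (dexp lambda 1 t - 1)) (fubini_denom lambda x).
  apply: (is_egf_lincomb x one).
  have := is_egf_lincomb 1 dexpE one.
  by congr is_egf; apply/funext => t; rewrite mul1r.
have linD k : bconv (linear_coef x) (D^~ x) k = a k.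
  apply: (is_egf_quotient k linE _ Ea (defD x)).
  by rewrite /linear_coef /bconv_unit/= mulr0 subr0 oner_eq0.
have fubF k : bconv (fubini_denom lambda x) (F^~ x) k = bconv_unit k.
  apply: (is_egf_quotient k fubE _ one).
    by rewrite /fubini_denom /dfalling big_ord0 subrr mulr0 subr0 oner_eq0.
  by have := defF x; congr is_egf; apply/funext => t; rewrite mulr1.
transitivity (bconv (stirling_tr St a) (F^~ x) n).
  exact: (stirling_tr_quotient n defS linD fubF).
apply: eq_bigr => j _; rewrite /stirling_tr mulr_sumr mulr_suml.
by apply: eq_bigr => l _; rewrite aE; ring.
Qed.
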